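(* For every real $d>0$ and every integer $n\ge 1$, $$\det(V_n(d))=R_{n+1}(d).$$
   Context: For $d>0$ and $n\ge 1$, $V_n(d)$ denotes the $n\times n$ tridiagonal Toeplitz matrix with all diagonal entries equal to $d+1$, all superdiagonal entries (positions $(i,i+1)$) equal to $1$, all subdiagonal entries (positions $(i+1,i)$) equal to $d$, and all other entries $0$. For $d>0$ and $m\ge 1$, the repunit of length $m$ in base $d$ is $R_m(d)=\sum_{j=0}^{m-1}d^{j}$ (so $R_m(1)=m$). *)

(* Defs.v *)
From mathcomp Require Import all_boot all_order all_algebra.
From mathcomp Require Import reals.

Set Implicit Arguments.
Unset Strict Implicit.
Unset Printing Implicit Defensive.

Import Order.TTheory GRing.Theory Num.Theory.
Local Open Scope ring_scope.

Definition Vmx (R : realType) (n : nat) (d : R) : 'M[R]_n :=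
  \matrix_(i < n, j < n)
    if i == j :> nat then d + 1
    else if j == i.+1 :> nat then 1
    else if i == j.+1 :> nat then d
    else 0.

Definition repunit (R : realType) (m : nat) (d : R) : R :=
  \sum_(0 <= j < m) d ^+ j.

(* Main.v *)
Require Import Defs.
From mathcomp Require Import all_boot all_order all_algebra.
From mathcomp Require Import reals.
From mathcomp Require Import ring.

Import Order.TTheory GRing.Theory Num.Theory.
Local Open Scope ring_scope.

(** Expanding the determinant along the first row leaves two terms. Deleting
    the first row and column of a tridiagonal Toeplitz matrix gives the same
    matrix one size smaller; the other minor has a first column with a single
    nonzero entry [d], so expanding it once more brings in the matrix two sizes
    smaller. This is the continuant recurrence [det_Vmx_rec],
    [D (n + 2) = (d + 1) * D (n + 1) - d * D n], with [D 0 = 1] and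
    [D 1 = d + 1]. Its characteristic roots are [1] and [d]: it says that
    [D (n + 2) - D (n + 1) = d * (D (n + 1) - D n)], so consecutive
    determinants differ by a power of [d], as consecutive repunits do. *)

(** Shifting both indices by one preserves [i - j], on which alone the entries
    depend. *)
Lemma Vmx_minor00 (R : realType) (d : R) (n : nat) :
  row' ord0 (col' ord0 (Vmx n.+1 d)) = Vmx n d.
Proof. by apply/matrixP => i j; rewrite !mxE /= /bump /= !add1n !eqSS. Qed.

(** Two rows and two columns are removed in all: rows 0, 1 and columns 1, 0 in
    the indexing of the original matrix, so the second expansion lands again in
    the family. *)
Lemma det_Vmx_minor01 (R : realType) (d : R) (n : nat) :
  \det (row' ord0 (col' (lift ord0 ord0) (Vmx n.+2 d))) = d * \det (Vmx n d).
Proof.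
rewrite (expand_det_col _ ord0) big_ord_recl big1 ?addr0 => [|i _].
  rewrite !mxE /= /cofactor /= expr0 mul1r; congr (_ * \det _).
  by apply/matrixP => i j; rewrite !mxE /= /bump /= !add1n !eqSS.
by rewrite !mxE /= mul0r.
Qed.

Lemma det_Vmx_rec (R : realType) (d : R) (n : nat) :
  \det (Vmx n.+2 d) = (d + 1) * \det (Vmx n.+1 d) - d * \det (Vmx n d).
Proof.
rewrite (expand_det_row _ ord0) !big_ord_recl big1 ?addr0 => [|i _]; last first.
  by rewrite !mxE /= mul0r.
rewrite /cofactor Vmx_minor00 det_Vmx_minor01 !mxE /=.
by rewrite expr0 expr1; ring.
Qed.

Lemma repunitS (R : realType) (d : R) (m : nat) :
  repunit m.+1 d = repunit m d + d ^+ m.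
Proof. by rewrite /repunit big_nat_recr. Qed.

(** The recurrence has order two, so the induction carries two consecutive
    sizes; it starts at the empty matrix, whose determinant is [1]. *)
Lemma det_Vmx (R : realType) (d : R) (n : nat) :
  \det (Vmx n d) = repunit n.+1 d.
Proof.
suff: \det (Vmx n d) = repunit n.+1 d /\ \det (Vmx n.+1 d) = repunit n.+2 d.
  by case.
elim: n => [|n [IHn IHn1]]; last first.
  split=> //; rewrite det_Vmx_rec IHn IHn1 !repunitS !exprS; ring.
rewrite det_mx00 det_mx11 mxE /= !repunitS /repunit big_geq //.
by split; rewrite expr0 ?expr1; ring.
Qed.

Theorem lemma6p3 (R : realType) (d : R) (n : nat) (hd : 0 < d) (hn : (1 <= n)%N) :
  \det (Vmx n d) = repunit n.+1 d.
Proof. exact: det_Vmx. Qed.
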